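(* Let $R(z,t)\in\mathbb{C}[z,t]$ be a non-zero polynomial of degree at most $2$, and let $$F(x,y,z,t)=(x-z)^2+(y-t)^2+R(z,t).$$ Then $F$ is Cartesian if and only if there exists a constant $c\in\mathbb{C}$ such that $R(z,t)$ is divisible by $z+it-c$ or by $z-it-c$.
   Context: Here $i=\sqrt{-1}$. A polynomial $P(x,y,z,t)\in\mathbb{C}[x,y,z,t]$ is called Cartesian if it can be written as $P(x,y,z,t)=G(x,y)F_1(x,y,z,t)+H(z,t)F_2(x,y,z,t)$, where $G\in\mathbb{C}[x,y]$ and $H\in\mathbb{C}[z,t]$ are non-constant polynomials and $F_1,F_2\in\mathbb{C}[x,y,z,t]$ are arbitrary. *)

(* Defs.v *)
From HB Require Import structures.
From mathcomp Require Import all_boot all_order all_algebra.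
From mathcomp Require Import mpoly.
From mathcomp Require Import reals complex.

Set Implicit Arguments.
Unset Strict Implicit.
Unset Printing Implicit Defensive.

Import GRing.Theory.
Local Open Scope ring_scope.

Section CartesianPolynomials.
Variable C : fieldType.

(* {mpoly C[4]} is read as C[x,y,z,t], with the variables in this order.  In the
   intended use C is K[i] with K : realType, i.e. the field of complex numbers. *)
Definition varx : {mpoly C[4]} := 'X_(@Ordinal 4 0 isT).
Definition vary : {mpoly C[4]} := 'X_(@Ordinal 4 1 isT).
Definition varz : {mpoly C[4]} := 'X_(@Ordinal 4 2 isT).
Definition vart : {mpoly C[4]} := 'X_(@Ordinal 4 3 isT).

(* C[x,y] and C[z,t] are both represented by {mpoly C[2]}; these are their
   inclusions into C[x,y,z,t]. *)
Definition in_xy (G : {mpoly C[2]}) : {mpoly C[4]} :=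
  G \mPo [tuple varx; vary].
Definition in_zt (H : {mpoly C[2]}) : {mpoly C[4]} :=
  H \mPo [tuple varz; vart].

Definition nonconstant (n : nat) (p : {mpoly C[n]}) : Prop :=
  forall c : C, p <> c%:MP.

(* [msize p] is one more than the total degree of p (and 0 for p = 0). *)
Definition mdeg_le (n : nat) (p : {mpoly C[n]}) (d : nat) : Prop :=
  (msize p <= d.+1)%N.

Definition mdvd (n : nat) (d p : {mpoly C[n]}) : Prop :=
  exists q : {mpoly C[n]}, p = q * d.

Definition Cartesian (P : {mpoly C[4]}) : Prop :=
  exists (G H : {mpoly C[2]}) (F1 F2 : {mpoly C[4]}),
    [/\ nonconstant G, nonconstant H & P = in_xy G * F1 + in_zt H * F2].

End CartesianPolynomials.

Arguments varx {C}.
Arguments vary {C}.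
Arguments varz {C}.
Arguments vart {C}.

(* Main.v *)
Require Import Defs.
From HB Require Import structures.
From mathcomp Require Import all_boot all_order all_algebra.
From mathcomp Require Import mpoly.
From mathcomp Require Import reals complex.
From mathcomp Require Import ring.

Import GRing.Theory.
Local Open Scope ring_scope.

(** With [u = x + i y], [v = x - i y], [w = z + i t], [s = z - i t], the
    polynomial [F] is [(u - w) (v - s) + R].  If [R = Q (w - c)], then
    [F = (u - c) (v - s) + (w - c) (Q - (v - s))].  Conversely, if
    [F = G F1 + H F2], then [F] vanishes on the product of the zero sets of [G]
    and [H], which are both infinite.  Hence the zero set of [G] lies on every
    conic [(u - w) (v - s) + R(w, s) = 0] with [(w, s)] a zero of [H].  This
    forces all zeros of [H] onto one line [w = c] (or [s = c]) on which [R]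
    vanishes infinitely often, so that [R] is divisible by the equation of that
    line. *)

(** * Polynomial induction and infinite sets *)

Lemma mpoly2_ind (C : fieldType) (P : {mpoly C[2]} -> Prop) :
  (forall c, P c%:MP) -> P 'X_(@Ordinal 2 0 isT) -> P 'X_(@Ordinal 2 1 isT) ->
  (forall p q, P p -> P q -> P (p + q)) ->
  (forall p q, P p -> P q -> P (p * q)) -> forall p, P p.
Proof.
move=> PC P0 P1 PD PM p; elim/mpolyind: p => [|c m p _ _ Pp].
  by rewrite -mpolyC0; apply: PC.
apply: (PD _ _ _ Pp); rewrite -mul_mpolyC; apply: (PM _ _ (PC c)).
rewrite mpolyXE_id.
apply: (big_ind P) => [||i _]; [exact: (PC 1) | exact: PM |].
have PX k q : P q -> P (q ^+ k).
  by move=> Pq; elim: k => [|k IHk]; [exact: (PC 1) | rewrite exprS; apply: PM].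
apply: PX.
case: i => -[|[|//]] ilt; first by rewrite (bool_irrelevance ilt isT).
by rewrite (bool_irrelevance ilt isT).
Qed.

Definition infinite_pred (T : eqType) (A : T -> Prop) : Prop :=
  forall s : seq T, exists2 a, a \notin s & A a.

(** A finite list containing every [f a] would pull back along [g] to a finite list containing all
    of [A]. *)
Lemma infinite_pred_image (T U : eqType) (A : T -> Prop) (B : U -> Prop)
    (f : T -> U) (g : U -> T) :
  infinite_pred T A -> (forall a, A a -> g (f a) = a) ->
  (forall a, A a -> B (f a)) -> infinite_pred U B.
Proof.
move=> Ainf fK AB s; have [a as_ Aa] := Ainf (map g s).
exists (f a); last exact: AB.
by apply: contra as_ => fas; rewrite -(fK a Aa) map_f.
Qed.

Lemma infinite_roots_eq0 (C : fieldType) (p : {poly C}) :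
  infinite_pred C (fun a => p.[a] = 0) -> p = 0.
Proof.
move=> pinf; apply/eqP/negPn/negP => p0.
have H n : exists s : seq C, [/\ uniq s, all (root p) s & size s = n].
  elim: n => [|n [s [us rs ss]]]; first by exists [::].
  have [a as_ pa] := pinf s.
  by exists (a :: s); split; rewrite /= ?as_ ?rs ?ss // /root pa eqxx.
have [s [us rs ss]] := H (size p).
by have := max_poly_roots p0 rs us; rewrite ss ltnn.
Qed.

Lemma closed_field_avoid (C : closedFieldType) (p : {poly C}) (s : seq C) :
  p != 0 -> exists2 a, a \notin s & p.[a] != 0.
Proof.
move=> p0.
(* The extra factors make every element of [s] a root, so a non-root of the product avoids [s]. *)
have /closed_nonrootP[a] : p * \prod_(x <- s) ('X - x%:P) != 0.
  by rewrite mulf_neq0 // monic_neq0 // monic_prod_XsubC.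
rewrite rootM negb_or root_prod_XsubC => /andP[pa as_].
by exists a.
Qed.

(** * Zeros and division of bivariate polynomials *)

Section TwoVariables.
Variable C : closedFieldType.
Implicit Types (p q R G : {mpoly C[2]}) (a b c e : C).

Let X0 : {mpoly C[2]} := 'X_(@Ordinal 2 0 isT).
Let X1 : {mpoly C[2]} := 'X_(@Ordinal 2 1 isT).

Definition pt2 (a b : C) : 'I_2 -> C := fun k => if val k is 0 then a else b.

(** Reads an element of C[x][y], outer variable y, in C[x,y]; through it a bivariate polynomial gets
    a leading coefficient in y and univariate roots. *)
Definition mpoly2_of_bipoly (B : {poly {poly C}}) : {mpoly C[2]} :=
  (map_poly (horner_alg X0) B).[X1].

Lemma mpoly2_of_bipolyC (u : {poly C}) :
  mpoly2_of_bipoly u%:P = horner_alg X0 u.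
Proof. by rewrite /mpoly2_of_bipoly map_polyC hornerC. Qed.

Lemma mpoly2_of_bipolyCC c : mpoly2_of_bipoly c%:P%:P = c%:MP.
Proof. by rewrite mpoly2_of_bipolyC horner_algC alg_mpolyC. Qed.

Lemma mpoly2_of_bipoly_surj p : exists B, p = mpoly2_of_bipoly B.
Proof.
elim/mpoly2_ind: p => [c|||_ _ [A ->] [B ->]|_ _ [A ->] [B ->]].
- by exists c%:P%:P; rewrite mpoly2_of_bipolyCC.
- by exists ('X%:P); rewrite mpoly2_of_bipolyC horner_algX.
- by exists 'X; rewrite /mpoly2_of_bipoly map_polyX hornerX.
- by exists (A + B); rewrite /mpoly2_of_bipoly rmorphD hornerD.
- by exists (A * B); rewrite /mpoly2_of_bipoly rmorphM hornerM.
Qed.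

Lemma meval_horner_alg a b (u : {poly C}) :
  (horner_alg X0 u).@[pt2 a b] = u.[a].
Proof.
elim/poly_ind: u => [|u c IH]; first by rewrite rmorph0 meval0 horner0.
rewrite rmorphD rmorphM /= horner_algX horner_algC alg_mpolyC mevalD mevalM.
by rewrite IH mevalXU mevalC !hornerE.
Qed.

Lemma meval_mpoly2_of_bipoly a b (B : {poly {poly C}}) :
  (mpoly2_of_bipoly B).@[pt2 a b] = (map_poly (horner_eval a) B).[b].
Proof.
rewrite /mpoly2_of_bipoly.
elim/poly_ind: B => [|B u IH]; first by rewrite !rmorph0 !horner0 meval0.
rewrite !rmorphD !rmorphM /= !map_polyX !map_polyC !hornerE mevalD mevalM IH.
by rewrite mevalXU meval_horner_alg.
Qed.

(** If y does not occur, a root in x gives a whole line of zeros. Otherwise the leading coefficient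
    in y is non-zero at some x outside any finite list, and above such an x there is a root in y. *)
Lemma infinite_zeros G : nonconstant G ->
  infinite_pred (C * C)%type (fun u => G.@[pt2 u.1 u.2] = 0).
Proof.
have [B ->] := mpoly2_of_bipoly_surj G => nc s.
have avoid1 a b : a \notin map fst s -> (a, b) \notin s.
  by apply: contra => /(map_f fst).
have avoid2 a b : b \notin map snd s -> (a, b) \notin s.
  by apply: contra => /(map_f snd).
have [sB|sB] := leqP (size B) 1.
  have [u Bu] : exists u, B = u%:P by exists B`_0; exact: size1_polyC.
  have [su|su] := leqP (size u) 1.
    by case: (nc u`_0); rewrite Bu {1}(size1_polyC su) mpoly2_of_bipolyCC.
  have /closed_rootP[a /eqP ua] : size u != 1 by rewrite gtn_eqF.
  have [b bs _] := closed_field_avoid C 1 (map snd s) (oner_neq0 _).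
  exists (a, b); first exact: avoid2.
  by rewrite /= Bu mpoly2_of_bipolyC meval_horner_alg.
have B0 : B != 0 by rewrite -size_poly_gt0 ltnW.
have [a as_ la] := closed_field_avoid C (lead_coef B) (map fst s)
  (etrans (congr1 negb (lead_coef_eq0 B)) B0).
(* Since the leading coefficient survives at [a], specialisation keeps the degree in y. *)
have /closed_rootP[b /eqP rb] : size (map_poly (horner_eval a) B) != 1.
  by rewrite size_map_poly_id0 // gtn_eqF.
exists (a, b); first exact: avoid1.
by rewrite /= meval_mpoly2_of_bipoly.
Qed.

(** Modulo the linear form, [X0] becomes [c - e *: X1], so every remainder can be written in [X1]
    alone. *)
Lemma mpoly2_division p e c : exists (q : {mpoly C[2]}) (u : {poly C}),
  p = q * (X0 + e *: X1 - c%:MP) + (map_poly (@mpolyC 2 C) u).[X1].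
Proof.
elim/mpoly2_ind: p
  => [d|||_ _ [q [u ->]] [q' [u' ->]]|_ _ [q [u ->]] [q' [u' ->]]].
- by exists 0, d%:P; rewrite map_polyC hornerC mul0r add0r.
- exists 1, (c%:P - e *: 'X).
  rewrite -mul_polyC rmorphB rmorphM /= !map_polyC map_polyX !hornerE /=.
  by rewrite -mul_mpolyC -/X0; ring.
- by exists 0, 'X; rewrite map_polyX hornerX mul0r add0r.
- by exists (q + q'), (u + u'); rewrite rmorphD hornerD; ring.
- set l := X0 + _ - _; set r := _.[X1]; set r' := _.[X1].
  exists (q * q' * l + q * r' + q' * r), (u * u').
  by rewrite rmorphM hornerM -/r -/r'; ring.
Qed.

(** On the line the quotient term vanishes, so the univariate remainder has infinitely many
    roots. *)
Lemma mdvd_line R e c :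
  infinite_pred C (fun b => R.@[pt2 (c - e * b) b] = 0) ->
  mdvd (X0 + e *: X1 - c%:MP) R.
Proof.
have [q [u ->]] := mpoly2_division R e c => Rinf.
suff -> : u = 0 by exists q; rewrite rmorph0 horner0 addr0.
apply: infinite_roots_eq0 => s; have [b bs Rb] := Rinf s.
exists b => //; move: Rb.
rewrite mevalD mevalM mevalB mevalD mevalZ !mevalXU mevalC /= subrK subrr.
rewrite mulr0 add0r => <-.
elim/poly_ind: (u) => [|v d IH]; first by rewrite rmorph0 !horner0 meval0.
rewrite rmorphD rmorphM /= map_polyX map_polyC !hornerE mevalD mevalM.
by rewrite mevalXU mevalC -IH.
Qed.

End TwoVariables.

(** * Families of hyperbolas with infinitely many common points *)

Section Hyperbolas.
Variables (C : fieldType) (A B : C * C -> Prop) (r : C * C -> C).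

(* Subtracting the equations of two points of [B] puts [A] on a line
   [v = k u + d]; substituting it into [(u - w) (v - s) + r = 0] gives a
   polynomial in [u] that vanishes identically, and its coefficients give
   [k = 0], [s = d], [r = 0]. *)
Lemma hyperbolas_through_graph (p1 p2 : C * C) :
  infinite_pred (C * C)%type A ->
  (forall p q, A p -> B q -> (p.1 - q.1) * (p.2 - q.2) + r q = 0) ->
  B p1 -> B p2 -> p1.1 != p2.1 ->
  exists d, forall q, B q -> q.2 = d /\ r q = 0.
Proof.
move=> Ainf AB B1 B2 ne.
have ne' : p1.1 - p2.1 != 0 by rewrite subr_eq0.
set k := - (p1.2 - p2.2) / (p1.1 - p2.1).
set d := (p1.1 * p1.2 + r p1 - p2.1 * p2.2 - r p2) / (p1.1 - p2.1).
have Aline p : A p -> p.2 = k * p.1 + d.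
  move=> Ap; have E1 := AB _ _ Ap B1; have E2 := AB _ _ Ap B2.
  have E : (p.1 - p1.1) * (p.2 - p1.2) + r p1 =
           (p.1 - p2.1) * (p.2 - p2.2) + r p2 by rewrite E1 E2.
  have kE : k * (p1.1 - p2.1) = - (p1.2 - p2.2) by rewrite mulfVK.
  have dE : d * (p1.1 - p2.1) = p1.1 * p1.2 + r p1 - p2.1 * p2.2 - r p2.
    by rewrite mulfVK.
  apply: (mulIf ne'); rewrite mulrDl mulrAC kE dE.
  apply/eqP; rewrite -subr_eq0; apply/eqP; move/eqP: E.
  by rewrite -subr_eq0 => /eqP E; rewrite -[RHS]oppr0 -[in RHS]E; ring.
clearbody k d; exists d => q Bq.
have P0 : k%:P * 'X^2 + (d - q.2 - q.1 * k)%:P * 'X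
          + (r q - q.1 * (d - q.2))%:P = 0.
  apply: infinite_roots_eq0.
  (* [A] is a graph over its first coordinate, so that coordinate takes infinitely many values. *)
  apply: (infinite_pred_image _ _ A _ fst (fun u => (u, k * u + d))) => //.
    by move=> [u v] /Aline /= <-.
  move=> p Ap; have := AB _ _ Ap Bq; rewrite (Aline _ Ap) => E.
  by rewrite !(hornerD, hornerM, hornerC, hornerX, hornerXn) -[RHS]E; ring.
have cf i := congr1 (fun p : {poly C} => p`_i) P0.
have := cf 2; have := cf 1%N; have := cf 0%N.
rewrite !coefD !coefCM !coefXn !coefX !coefC /=.
rewrite !mulr0 !mulr1 !addr0 !add0r => c0 c1 c2.
have dq : d - q.2 = 0 by rewrite -c1 c2 mulr0 subr0.
split; first by apply/esym/eqP; rewrite -subr_eq0 dq.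
by rewrite -c0 dq mulr0 subr0.
Qed.
End Hyperbolas.

(** Two distinct points of [B] differ in some coordinate. If only in the second, exchanging the
    coordinates, a symmetry of the equation, reduces to the graph case. *)
Lemma hyperbolas_through_infinite_set (C : fieldType) (A B : C * C -> Prop)
    (r : C * C -> C) :
  infinite_pred (C * C)%type A -> infinite_pred (C * C)%type B ->
  (forall p q, A p -> B q -> (p.1 - q.1) * (p.2 - q.2) + r q = 0) ->
  exists d, (forall q, B q -> q.1 = d /\ r q = 0) \/
            (forall q, B q -> q.2 = d /\ r q = 0).
Proof.
move=> Ainf Binf AB.
have [p1 _ B1] := Binf [::]; have [p2 p21 B2] := Binf [:: p1].
have [e1|ne] := eqVneq p1.1 p2.1; last first.
  have [d dP] := hyperbolas_through_graph C A B r p1 p2 Ainf AB B1 B2 ne.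
  by exists d; right.
pose sw (u : C * C) := (u.2, u.1).
have swK u : sw (sw u) = u by case: u.
have ne : (sw p1).1 != (sw p2).1.
  apply: contraNneq p21 => /= e2; rewrite inE.
  by case: p1 p2 e1 e2 {B1 B2} => [? ?] [? ?] /= -> ->.
have [|p q Ap Bq|||d dP] := hyperbolas_through_graph C (A \o sw) (B \o sw)
  (r \o sw) (sw p1) (sw p2) _ _ _ _ ne.
- by apply: (infinite_pred_image _ _ A _ sw sw) => // a; rewrite /= swK.
- by rewrite mulrC; apply: (AB _ _ Ap Bq).
- by rewrite /= swK.
- by rewrite /= swK.
exists d; left => q Bq.
by have := dP (sw q); rewrite /= swK; apply.
Qed.

(** * Isotropic coordinates and the two implications *)

Section IsotropicForm.
Variables (C : closedFieldType) (e : C).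
Hypotheses (e2 : e * e = -1) (two_neq0 : 2%:R != 0 :> C).
Variable R : {mpoly C[2]}.

Let F : {mpoly C[4]} := (varx - varz) ^+ 2 + (vary - vart) ^+ 2 + in_zt R.

(* In the coordinates [u = x + e y], [v = x - e y] the quadratic form [x^2 + y^2] is [u v]. *)
Let iso (p : C * C) : C * C := (p.1 + e * p.2, p.1 - e * p.2).
(** Inverts [iso]: y is (u - v) / (2 e), and 1 / e is [- e]. *)
Let osi (p : C * C) : C * C :=
  ((p.1 + p.2) / 2%:R, - e * ((p.1 - p.2) / 2%:R)).

Let isoK p : osi (iso p) = p.
Proof.
case: p => x y; rewrite /osi /iso /=; congr pair.
  by rewrite -[RHS](mulfK two_neq0); congr (_ / _); ring.
rewrite mulrA; apply: (mulIf two_neq0); rewrite mulfVK //.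
have -> : y * 2%:R = - (-1) * y * 2%:R by ring.
by rewrite -e2; ring.
Qed.

Let pt4 (p q : C * C) : 'I_4 -> C :=
  fun k => nth 0 [:: p.1; p.2; q.1; q.2] k.

Lemma meval_in_xy (G : {mpoly C[2]}) p q :
  (in_xy G).@[pt4 p q] = G.@[pt2 C p.1 p.2].
Proof.
rewrite /in_xy comp_mpoly_meval; apply: meval_eq => -[[|[|//]] ilt];
  by rewrite (tnth_nth 0) /= mevalXU.
Qed.

Lemma meval_in_zt (H : {mpoly C[2]}) p q :
  (in_zt H).@[pt4 p q] = H.@[pt2 C q.1 q.2].
Proof.
rewrite /in_zt comp_mpoly_meval; apply: meval_eq => -[[|[|//]] ilt];
  by rewrite (tnth_nth 0) /= mevalXU.
Qed.

Lemma Cartesian_mdvd : Cartesian F -> exists c,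
  mdvd ('X_(@Ordinal 2 0 isT) + e *: 'X_(@Ordinal 2 1 isT) - c%:MP) R \/
  mdvd ('X_(@Ordinal 2 0 isT) - e *: 'X_(@Ordinal 2 1 isT) - c%:MP) R.
Proof.
move=> [G [H [F1 [F2 [Gnc Hnc FE]]]]].
pose VG p := G.@[pt2 C p.1 p.2] = 0; pose VH p := H.@[pt2 C p.1 p.2] = 0.
have Ginf : infinite_pred _ VG := infinite_zeros C G Gnc.
have Hinf : infinite_pred _ VH := infinite_zeros C H Hnc.
have FV p q : VG p -> VH q ->
    ((iso p).1 - (iso q).1) * ((iso p).2 - (iso q).2)
    + R.@[pt2 C q.1 q.2] = 0.
  move=> Gp Hq; have := congr1 (meval (pt4 p q)) FE.
  rewrite !mevalD !mevalM !meval_in_xy !meval_in_zt Gp Hq !mul0r addr0.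
  rewrite !mevalB !mevalXU /= => <-; congr (_ + _).
  set a := p.1 - q.1; set b := p.2 - q.2.
  transitivity (a * a - e * e * (b * b)); first by rewrite /a /b; ring.
  by rewrite e2; ring.
have iso_inf A : infinite_pred (C * C)%type A ->
    infinite_pred (C * C)%type (fun u => exists2 p, A p & iso p = u).
  move=> Ainf; apply: (infinite_pred_image _ _ A _ iso osi) => // p Ap.
  by exists p.
(* The second coordinate parametrises the line, so the infinite set [VH] supplies infinitely many
   zeros of [R] on it. Here [f] will be [e] or [- e]. *)
have line d f : (forall q, VH q -> q.1 + f * q.2 = d /\ R.@[pt2 C q.1 q.2] = 0)
    -> mdvd ('X_(@Ordinal 2 0 isT) + f *: 'X_(@Ordinal 2 1 isT) - d%:MP) R.
  move=> VHd; apply: mdvd_line.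
  apply: (infinite_pred_image _ _ VH _ snd (fun b => (d - f * b, b))) => // q.
    by move=> /VHd[<- _]; rewrite addrK; case: q.
  by move=> /VHd[<- Rq]; rewrite addrK.
have [||_ _ [p Gp <-] [q Hq <-]|d dP] := hyperbolas_through_infinite_set C
  (fun u => exists2 p, VG p & iso p = u) (fun u => exists2 p, VH p & iso p = u)
  (fun u => R.@[pt2 C (osi u).1 (osi u).2]).
- exact: iso_inf.
- exact: iso_inf.
- by rewrite isoK; apply: FV.
exists d; case: dP => dP; [left | right; rewrite -scaleNr];
  apply: line => q Hq; have := dP _ (ex_intro2 _ _ q Hq erefl);
  by rewrite isoK /= ?mulNr.
Qed.

Lemma line_nonconstant (f c : C) :
  nonconstant
    ('X_(@Ordinal 2 0 isT) + f *: 'X_(@Ordinal 2 1 isT) - c%:MP : {mpoly C[2]}).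
Proof.
move=> d E; have ev a : a + f * 0 - c = d.
  have := congr1 (meval (pt2 C a 0)) E.
  by rewrite mevalB mevalD mevalZ !mevalXU !mevalC.
(* The form takes different values at (1, 0) and (0, 0). *)
have := ev 1; rewrite -(ev 0).
by move/addIr/addIr/eqP; rewrite oner_eq0.
Qed.

Lemma mdvd_Cartesian (f c : C) : f * f = -1 ->
  mdvd ('X_(@Ordinal 2 0 isT) + f *: 'X_(@Ordinal 2 1 isT) - c%:MP) R ->
  Cartesian F.
Proof.
move=> f2 [Q RQ].
pose l : {mpoly C[2]} :=
  'X_(@Ordinal 2 0 isT) + f *: 'X_(@Ordinal 2 1 isT) - c%:MP.
(* This is v - s of the overview. With G = H = [l] the constant [c] cancels in l(x,y) - l(z,t),
   whose product with [v] is the quadratic part of [F]. *)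
pose v := varx - varz - f%:MP * (vary - vart) : {mpoly C[4]}.
exists l, l, v, (in_zt Q - v); split; try exact: line_nonconstant.
have xyl : in_xy l = varx + f%:MP * vary - c%:MP.
  rewrite /in_xy /l comp_mpolyB comp_mpolyD comp_mpolyZ comp_mpolyC.
  by rewrite !comp_mpolyXU /= mul_mpolyC.
have ztl : in_zt l = varz + f%:MP * vart - c%:MP.
  rewrite /in_zt /l comp_mpolyB comp_mpolyD comp_mpolyZ comp_mpolyC.
  by rewrite !comp_mpolyXU /= mul_mpolyC.
have -> : F = (varx - varz) ^+ 2 + (vary - vart) ^+ 2 + in_zt Q * in_zt l.
  by rewrite /F RQ /in_zt rmorphM.
rewrite xyl ztl /v.
have f2m : f%:MP * f%:MP = -1 :> {mpoly C[4]}.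
  by rewrite -mpolyCM f2 mpolyCN.
set x := varx; set y := vary; set z := varz; set t := vart.
set g := f%:MP; set qq := in_zt Q; set k := c%:MP.
(* Exposing [- 1] lets it be replaced by the square of [f], after which the identity holds
   formally. *)
have -> : (x - z) ^+ 2 + (y - t) ^+ 2 + qq * (z + g * t - k)
  = (x - z) ^+ 2 - (- 1) * (y - t) ^+ 2 + qq * (z + g * t - k) by ring.
by rewrite -f2m -/g; ring.
Qed.

End IsotropicForm.

Theorem mainTheorem4 (K : realType) (R : {mpoly K[i]%C[2]})
    (R_neq0 : R <> 0) (R_deg : mdeg_le R 2) :
  let z : {mpoly K[i]%C[2]} := 'X_(@Ordinal 2 0 isT) in
  let t : {mpoly K[i]%C[2]} := 'X_(@Ordinal 2 1 isT) in
  let F : {mpoly K[i]%C[4]} :=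
    (varx - varz) ^+ 2 + (vary - vart) ^+ 2 + in_zt R in
  Cartesian F <->
  exists c : K[i]%C,
    mdvd (z + 'i%C *: t - c%:MP) R \/ mdvd (z - 'i%C *: t - c%:MP) R.
Proof.
have i2 : 'i%C * 'i%C = -1 :> K[i]%C by rewrite -expr2 sqr_i.
move=> z t F; split=> [|[c [|]]].
- by apply: Cartesian_mdvd => //; rewrite Num.Theory.pnatr_eq0.
- exact: mdvd_Cartesian.
- by rewrite -scaleNr; apply: mdvd_Cartesian; rewrite mulrNN.
Qed.
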